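(* For every cost function $g$ as in the context, the min-LCR algorithm is an optimal deterministic online algorithm for the problem with hidden deadlines, i.e. its competitive ratio $\mathsf{r}_{\text{min-LCR}}=\sup_{\boldsymbol{\sigma}} C_{\mathsf{OFF}}(\boldsymbol{\sigma})/C_{\text{min-LCR}}(\boldsymbol{\sigma})$ equals the optimal competitive ratio $\mathsf{r}^\star=\inf_{\mathsf{ALG}}\sup_{\boldsymbol{\sigma}} C_{\mathsf{OFF}}(\boldsymbol{\sigma})/C_{\mathsf{ALG}}(\boldsymbol{\sigma})$, where the infimum is over all deterministic online algorithms.
   Context: Model: time is divided into slots $t=1,2,\dots$. An input $\boldsymbol{\sigma}$ is a finite sequence of jobs; job $J_i$ arrives at the beginning of slot $a_i$, has a value $v_i>0$ and an absolute deadline $D_i\in\{a_i,a_i+1,\dots\}\cup\{\infty\}$; it may be processed in any single slot $t$ with $a_i\le t\le D_i$ (each job takes one slot and is processed at most once), otherwise it is dropped. In any slot, any number $k\ge0$ of jobs can be processed at energy cost $g(k)$, where $g$ is convex on the nonnegative integers with $g(0)=0$ and $c_k=g(k)-g(k-1)>0$ for all $k\ge1$. An algorithm processing job set $P_t$ in slot $t$ earns profit $C(\boldsymbol{\sigma})=\sum_t\big(\sum_{i\in P_t}v_i-g(|P_t|)\big)$. A deterministic online algorithm decides at each slot $t$ which available jobs to process, knowing only the jobs that have arrived by slot $t$, their values, and which of them are still available (not yet expired and not yet processed); it does not know deadlines in advance (they may be chosen adversarially) nor future arrivals. $C_{\mathsf{OFF}}(\boldsymbol{\sigma})$ is the optimal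 profit of an offline algorithm knowing the entire input including all deadlines. min-LCR algorithm: at slot $\tau$, let $E(\tau)$ be the set of jobs available at $\tau$ (arrived by $\tau$, not expired, not yet processed by the algorithm), sorted in non-increasing order of value; let $v^{(j)}$ be the $j$-th largest value and $V^{(j)}=\sum_{l\le j}v^{(l)}$. Let $m$ be the largest $j$ with $v^{(j)}-(g(j)-g(j-1))>0$ (if none, process nothing). For $1\le i\le m$ define $M_{i,\tau}=V^{(i)}-i\,g(1)$, $P_{i,\tau}=V^{(i)}-g(i)$, $C_{\mathsf{Greedy}}(i,\tau)=$ the maximum over $j\ge0$ of (sum of the $j$ largest values among the jobs of $E(\tau)$ other than the top $i$) $-\,g(j)$, and $\mathsf{LCR}_i(\tau)=\dfrac{M_{i,\tau}+C_{\mathsf{Greedy}}(i,\tau)}{P_{i,\tau}}$. Let $i^\star(\tau)=\arg\min_{1\le i\le m}\mathsf{LCR}_i(\tau)$ and process the $i^\star(\tau)$ highest-valued jobs of $E(\tau)$ in slot $\tau$. *)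

(* Defs.v *)
From HB Require Import structures.
From mathcomp Require Import all_boot all_order all_algebra.
From mathcomp Require Import finmap.
From mathcomp Require Import all_classical all_reals ereal.
Set Implicit Arguments.
Unset Strict Implicit.
Unset Printing Implicit Defensive.
Import Order.TTheory GRing.Theory Num.Theory.
Local Open Scope classical_set_scope.
Local Open Scope fset_scope.
Local Open Scope ring_scope.

Record cost_function (R : realType) (g : nat -> R) : Prop := CostFunction {
  cost0 : g 0%N = 0;
  cost_incr : forall k : nat, 0 < g k.+1 - g k;
  cost_convex : forall k : nat, g k.+1 - g k <= g k.+2 - g k.+1 }.

(* A deadline [None] is infinite. *)
Record job (R : realType) := Job {
  arrival : nat;
  value : R;
  deadline : option nat }.

Definition by_deadline (t : nat) (D : option nat) : bool :=
  if D is Some d then (t <= d)%N else true.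

Definition valid_job (R : realType) (j : job R) : bool :=
  [&& (0 < arrival j)%N, 0 < value j & by_deadline (arrival j) (deadline j)].

(* Jobs are named by their position in the input. They are listed by order of
   arrival, so that the name of a job says nothing about later arrivals. *)
Definition valid_input (R : realType) (sigma : seq (job R)) : bool :=
  all (@valid_job R) sigma && sorted leq (map (@arrival R) sigma).

Definition job_at (R : realType) (sigma : seq (job R)) (i : nat) : job R :=
  nth (Job 0 0 None) sigma i.

Definition value_at (R : realType) (sigma : seq (job R)) (i : nat) : R :=
  value (job_at sigma i).

Definition live (R : realType) (sigma : seq (job R)) (t i : nat) : bool :=
  (arrival (job_at sigma i) <= t)%N &&
  by_deadline t (deadline (job_at sigma i)).

(* [P t] is the set of jobs processed in slot [t]; slots are numbered from 1
   and [P 0] is ignored. *)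
Definition feasible (R : realType) (sigma : seq (job R))
    (P : nat -> {fset nat}) : Prop :=
  (forall t i : nat, (0 < t)%N -> i \in P t ->
     (i < size sigma)%N /\ live sigma t i) /\
  (forall t u i : nat, (0 < t)%N -> (0 < u)%N ->
     i \in P t -> i \in P u -> t = u).

(* The sum has finite support: if [P] is feasible and [g 0 = 0] then every slot
   in which nothing is processed contributes 0. *)
Definition profit (R : realType) (g : nat -> R) (sigma : seq (job R))
    (P : nat -> {fset nat}) : R :=
  \sum_(t \in [set t : nat | (0 < t)%N])
    (\sum_(i <- P t) value_at sigma i - g #|` P t|).

Definition C_OFF (R : realType) (g : nat -> R) (sigma : seq (job R)) : R :=
  sup [set profit g sigma P | P in feasible sigma].

(* What is observed in one slot [t]: the arrival slots and values of the jobs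
   [0, 1, ..] that have arrived by [t], and the names of those still available. *)
Record view (R : realType) := View {
  known : seq (nat * R);
  avail : {fset nat} }.

(* A deterministic algorithm maps the observations of the slots [1 .. t] to the
   jobs to be processed in slot [t]; unavailable jobs in its answer are ignored
   (see [decide]). *)
Definition online_algorithm (R : realType) : Type := seq (view R) -> {fset nat}.

Definition last_view (R : realType) (h : seq (view R)) : view R :=
  last (View [::] fset0) h.

Definition decide (R : realType) (A : online_algorithm R) (h : seq (view R)) :
    {fset nat} :=
  avail (last_view h) `&` A h.

Definition available (R : realType) (sigma : seq (job R)) (t : nat)
    (done : {fset nat}) : {fset nat} :=
  [fset i in iota 0 (size sigma) | live sigma t i && (i \notin done)].

Definition view_at (R : realType) (sigma : seq (job R)) (t : nat)
    (E : {fset nat}) : view R :=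
  View [seq (arrival j, value j) | j <- sigma & (arrival j <= t)%N] E.

(* The observations of the slots [1 .. t], and the jobs processed in them. *)
Fixpoint exec (R : realType) (A : online_algorithm R) (sigma : seq (job R))
    (t : nat) : seq (view R) * {fset nat} :=
  if t is s.+1 then
    let: (h, done) := exec A sigma s in
    let h' := rcons h (view_at sigma t (available sigma t done)) in
    (h', done `|` decide A h')
  else ([::], fset0).

(* The set E(t), for [0 < t]. *)
Definition available_at (R : realType) (A : online_algorithm R)
    (sigma : seq (job R)) (t : nat) : {fset nat} :=
  available sigma t (exec A sigma t.-1).2.

Definition processed_at (R : realType) (A : online_algorithm R)
    (sigma : seq (job R)) (t : nat) : {fset nat} :=
  decide A (exec A sigma t).1.

Definition C_ALG (R : realType) (g : nat -> R) (A : online_algorithm R)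
    (sigma : seq (job R)) : R :=
  profit g sigma (processed_at A sigma).

(* Since [alg <= off] and [0 <= off], this is the least [r >= 1] such that
   [off <= r * alg], and [+oo] if there is none: an algorithm without profit on
   an input has infinite ratio there, unless [off = alg = 0]. *)
Definition profit_ratio (R : realType) (off alg : R) : \bar R :=
  if 0 < alg then (off / alg)%:E
  else if (off == 0) && (alg == 0) then 1%:E else +oo%E.

Definition competitive_ratio (R : realType) (g : nat -> R)
    (A : online_algorithm R) : \bar R :=
  ereal_sup [set profit_ratio (C_OFF g sigma) (C_ALG g A sigma) |
             sigma in [set sigma : seq (job R) | valid_input sigma]].

Definition optimal_competitive_ratio (R : realType) (g : nat -> R) : \bar R :=
  ereal_inf [set competitive_ratio g A | A in [set: online_algorithm R]].

(* Below, [s] lists the values of the available jobs in non-increasing order. *)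
Definition sorted_values (R : realType) (v : nat -> R) (E : {fset nat}) :
    seq R :=
  sort >=%R [seq v i | i <- E].

Definition top_sum (R : realType) (s : seq R) (j : nat) : R :=
  \sum_(x <- take j s) x.

(* Equal to 0 if there is no such [j]. *)
Definition max_profitable (R : realType) (g : nat -> R) (s : seq R) : nat :=
  (\max_(j < (size s).+1 | (0 < j)%N && (0 < s`_j.-1 - (g j - g j.-1))%R) j)%N.

Definition M_lcr (R : realType) (g : nat -> R) (s : seq R) (i : nat) : R :=
  top_sum s i - i%:R * g 1%N.

Definition P_lcr (R : realType) (g : nat -> R) (s : seq R) (i : nat) : R :=
  top_sum s i - g i.

(* The term [j = 0] is [- g 0 = 0], so the default value 0 is harmless. *)
Definition C_Greedy (R : realType) (g : nat -> R) (s : seq R) (i : nat) : R :=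
  \big[Num.max/0]_(j < (size (drop i s)).+1) (top_sum (drop i s) j - g j).

Definition LCR (R : realType) (g : nat -> R) (s : seq R) (i : nat) : R :=
  (M_lcr g s i + C_Greedy g s i) / P_lcr g s i.

Definition is_argmin_LCR (R : realType) (g : nat -> R) (s : seq R) (i : nat) :
    Prop :=
  (0 < i <= max_profitable g s)%N /\
  forall k : nat, (0 < k <= max_profitable g s)%N -> LCR g s i <= LCR g s k.

(* With ties, several sets [S] qualify. *)
Definition is_top (R : realType) (v : nat -> R) (E : {fset nat}) (i : nat)
    (S : {fset nat}) : Prop :=
  [/\ S `<=` E, #|` S| = i &
      forall x y : nat, x \in S -> y \in E -> y \notin S -> v y <= v x].

Definition min_LCR_choice (R : realType) (g : nat -> R) (v : nat -> R)
    (E S : {fset nat}) : Prop :=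
  let s := sorted_values v E in
  if max_profitable g s == 0%N then S = fset0
  else exists2 i : nat, is_argmin_LCR g s i & is_top v E i S.

(* Ties, both among equal values and in the argmin, may be broken in any way,
   and differently from slot to slot. *)
Definition is_min_LCR (R : realType) (g : nat -> R) (A : online_algorithm R) :
    Prop :=
  forall (sigma : seq (job R)) (t : nat), valid_input sigma -> (0 < t)%N ->
    min_LCR_choice g (value_at sigma) (available_at A sigma t)
      (processed_at A sigma t).

Lemma min_LCR_choice_ex (R : realType) (g v : nat -> R) (E : {fset nat}) :
  exists S : {fset nat}, min_LCR_choice g v E S.
Proof.
rewrite /min_LCR_choice; set s := sorted_values v E.
have [|m0] := eqVneq; first by exists fset0.
set m := max_profitable g s in m0 *.
have mE : (m <= size E)%N.
  rewrite /m /max_profitable; apply/bigmax_leqP => j _.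
  by rewrite -ltnS (leq_trans (ltn_ord j))// size_sort size_map.
pose Q : pred 'I_m.+1 := fun i => (0 < i)%N.
have Qm : Q ord_max by rewrite /Q /= lt0n.
case: (@arg_minP _ _ _ _ Q (fun i : 'I_m.+1 => LCR g s i) Qm) => i i0 imin.
pose r := relpre v (fun x y : R => y <= x).
have rtot : total r by move=> x y; rewrite /r /= le_total.
have rtr : transitive r by move=> y x z /= yx zy; exact: le_trans zy yx.
pose l := sort r E.
have lu : uniq l by rewrite sort_uniq fset_uniq.
have lE x : (x \in l) = (x \in E) by rewrite mem_sort.
exists [fset x in take i l]; exists (nat_of_ord i).
  split; first by apply/andP; split=> [|]; [exact: i0 | rewrite -ltnS ltn_ord].
  by move=> k /andP[k0 km]; exact: (imin (Ordinal (km : (k < m.+1)%N)) k0).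
have memS x : (x \in [fset x in take i l]) = (x \in take i l) by rewrite !inE.
split.
- by apply/fsubsetP => x; rewrite memS => /mem_take; rewrite lE.
- rewrite card_fseq undup_id ?take_uniq// size_takel// size_sort.
  by rewrite (leq_trans _ mE)// -ltnS ltn_ord.
- move=> x y; rewrite !memS => xS; rewrite -lE => yl yN.
  have yD : y \in drop i l.
    by move: yl; rewrite -{1}(cat_take_drop i l) mem_cat (negbTE yN).
  have : sorted r l by exact: sort_sorted.
  rewrite sorted_pairwise// -(cat_take_drop i l) pairwise_cat.
  by case/andP => /allrelP /(_ _ _ xS yD).
Qed.

Lemma eq_min_LCR_choice (R : realType) (g v w : nat -> R) (E S : {fset nat}) :
  {in E, v =1 w} -> min_LCR_choice g v E S -> min_LCR_choice g w E S.
Proof.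
move=> vw; rewrite /min_LCR_choice.
have -> : sorted_values w E = sorted_values v E.
  by congr sort; apply/eq_in_map => i iE; rewrite vw.
case: ifP => // _ [i Hi [SE cS top]]; exists i => //; split => // x y xS yE yS.
have xE : x \in E by exact: (fsubsetP SE).
by rewrite -(vw _ xE) -(vw _ yE); exact: top.
Qed.

Lemma known_value (R : realType) (sigma : seq (job R)) (t i : nat) :
  sorted leq (map (@arrival R) sigma) -> (i < size sigma)%N ->
  (arrival (job_at sigma i) <= t)%N ->
  (nth (0%N, 0) [seq (arrival j, value j) | j <- sigma & (arrival j <= t)%N]
    i).2 = value_at sigma i.
Proof.
elim: sigma i => [//|j s IH] i js.
have jmin k : (k < size s)%N -> (arrival j <= arrival (job_at s k))%N.
  move=> ks; move: js => /= /(order_path_min leq_trans)/allP; apply.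
  by rewrite -(nth_map _ 0%N)// mem_nth// size_map.
case: i => [|i] /=; rewrite /value_at /job_at /=; first by move=> _ ->.
rewrite ltnS => si ait.
rewrite (leq_trans (jmin _ si) ait) /= IH//.
exact: path_sorted js.
Qed.

(* The hypothesis [is_min_LCR g A] is never vacuous: the choice of the algorithm
   can be made from what it observes. *)
Lemma min_LCR_ex (R : realType) (g : nat -> R) :
  exists A : online_algorithm R, is_min_LCR g A.
Proof.
pose kv (w : view R) i := (nth (0%N, 0) (known w) i).2.
exists (fun h => xget fset0 (min_LCR_choice g (kv (last_view h))
                               (avail (last_view h)))).
set A := (X in is_min_LCR _ X).
move=> sigma [//|t] /andP[_ so] _.
rewrite /processed_at /available_at /=.
case: (exec A sigma t) => h d /=.
set E := available _ _ _; set h' := rcons _ _.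
have lh : last_view h' = view_at sigma t.+1 E by rewrite /last_view last_rcons.
have HA : min_LCR_choice g (kv (last_view h')) E (A h').
  rewrite /A lh /=; have [S HS] := min_LCR_choice_ex g
    (kv (view_at sigma t.+1 E)) E.
  exact: xgetI HS.
have AE : A h' `<=` E.
  move: HA; rewrite /min_LCR_choice; case: ifP => [_ ->|_ [i _ []//]].
  exact: fsub0set.
rewrite /decide lh /=; move/fsetIidPr: (AE) => ->.
apply: eq_min_LCR_choice HA => i; rewrite lh !inE mem_iota /= add0n.
case/andP => isz /andP[/andP[ai _] _]; exact: known_value.
Qed.

(* Main.v *)
Require Import Defs.
From mathcomp Require Import all_boot all_order all_algebra.
From mathcomp Require Import finmap ring lra.
From mathcomp Require Import all_classical all_reals ereal.
Set Implicit Arguments.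
Unset Strict Implicit.
Unset Printing Implicit Defensive.
Import Order.TTheory GRing.Theory Num.Theory.
Local Open Scope classical_set_scope.
Local Open Scope fset_scope.
Local Open Scope ring_scope.

(** Let [r >= 1] be a finite ratio achieved by some online algorithm [B].

    Lower bound: all jobs arrive in slot 1, with values [s]; [B] processes some
    set [S] of [k] jobs. The adversary lets the jobs outside [S] expire at once
    and those of [S] never expire, so that offline may process [S] at cost [g 1]
    per job in later slots, and a best subset of the other jobs in slot 1. The
    ratio is smallest when [S] consists of the [k] largest values, where it is
    [LCR g s k], and [k > m] is no better than [k = m]; hence [LCR g s k <= r]
    for some [1 <= k <= m].

    Upper bound: split the jobs that offline processes in slot [t] into those
    that min-LCR never processes and those that it processes at some time. By
    convexity the latter cost at least [g 1] each; summed over all slots they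
    contribute at most [M_lcr] of all slots of min-LCR. The former are available
    to min-LCR in slot [t] and not chosen, so they contribute at most
    [C_Greedy]. Hence in each slot the bound is [LCR * P_lcr <= r * P_lcr]. *)

(** * Convex cost functions *)

Section Cost.
Variables (R : realType) (g : nat -> R).
Hypothesis hg : cost_function g.

Lemma marginal_cost_mono j k : (j <= k)%N -> g j.+1 - g j <= g k.+1 - g k.
Proof.
elim: k => [|k IH]; first by rewrite leqn0 => /eqP->.
rewrite leq_eqVlt => /orP[/eqP->//|]; rewrite ltnS => /IH h.
exact: le_trans h (cost_convex hg k).
Qed.

Lemma marginal_cost_ge1 k : g 1%N <= g k.+1 - g k.
Proof. by have := marginal_cost_mono (leq0n k); rewrite (cost0 hg) subr0. Qed.

Lemma cost1_gt0 : 0 < g 1%N.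
Proof. by have := cost_incr hg 0; rewrite (cost0 hg) subr0. Qed.

(** Each of the [b] additional jobs has a marginal cost of at least [g 1]. This is how convexity
    separates the jobs that offline shares with min-LCR from the others. *)
Lemma cost_addn a b : g a + b%:R * g 1%N <= g (a + b)%N.
Proof.
elim: b => [|b IH]; first by rewrite addn0 mul0r addr0.
rewrite addnS mulrSr mulrDl mul1r.
have := marginal_cost_ge1 (a + b); lra.
Qed.

Lemma cost_ge_linear k : k%:R * g 1%N <= g k.
Proof. by have := cost_addn 0 k; rewrite (cost0 hg) add0r. Qed.

Lemma cost_ge0 k : 0 <= g k.
Proof.
apply: le_trans (cost_ge_linear k).
by rewrite mulr_ge0// ltW// cost1_gt0.
Qed.

End Cost.

(** * Sums of the largest entries of a sorted list *)

Section TopSum.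
Variable R : realType.
Implicit Types (s t : seq R) (x : R).

Lemma top_sum0 s : top_sum s 0 = 0.
Proof. by rewrite /top_sum take0 big_nil. Qed.

Lemma top_sum_cons x s j : top_sum (x :: s) j.+1 = x + top_sum s j.
Proof. by rewrite /top_sum /= big_cons. Qed.

Lemma top_sumS s j : (j < size s)%N -> top_sum s j.+1 = top_sum s j + s`_j.
Proof.
by move=> js; rewrite /top_sum (take_nth 0)// big_rcons /= addrC.
Qed.

Lemma sorted_ge_nth s i j : sorted >=%R s -> (i <= j < size s)%N -> s`_j <= s`_i.
Proof.
move=> so /andP[ij js].
apply: (sorted_leq_nth _ _ 0 so) => //; rewrite ?inE//.
- by move=> y x z /= yx zy; exact: le_trans zy yx.
- by move=> x /=.
- exact: leq_ltn_trans js.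
Qed.

Lemma sum_subseq_le_top_sum s t : sorted >=%R s -> subseq t s ->
  \sum_(x <- t) x <= top_sum s (size t).
Proof.
elim: s t => [|x s IH] [|y t] so //; rewrite ?big_nil ?top_sum0//.
have so' := path_sorted so.
have xmin : all (fun z => z <= x) s.
  by apply: (order_path_min _ so) => a b c /= ba ac; exact: le_trans ac ba.
move=> h; rewrite [size _]/= top_sum_cons big_cons lerD//.
  have : y \in x :: s.
    by apply: (mem_subseq (s1 := y :: t) h); rewrite mem_head.
  by rewrite inE => /orP[/eqP->//|/(allP xmin)].
apply: IH => //; move: h => /=; case: eqP => // _ /(@cons_subseq _ _ _ _); exact.
Qed.

(** Among all ways to remove a fixed number of entries, removing the largest leaves the least. The
    adversary argument uses it with [m] marking the jobs chosen by the algorithm. *)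
Lemma top_sum_drop_le_mask s (m : bitseq) j : sorted >=%R s -> size m = size s ->
  (j <= size (mask (map negb m) s))%N ->
  top_sum (drop (count id m) s) j <= top_sum (mask (map negb m) s) j.
Proof.
elim: s m j => [|x s IH] [|b m] j //= so [] sm.
have so' := path_sorted so.
have xmin : all (fun z => z <= x) s.
  by apply: (order_path_min _ so) => a c d /= ca ad; exact: le_trans ad ca.
case: b => /=; first by move=> h; exact: IH.
case: j => [|j]; first by rewrite !top_sum0.
rewrite ltnS => jm; rewrite top_sum_cons.
apply: le_trans (lerD (lexx x) (IH _ _ so' sm jm)).
(* The unmarked head [x] is matched with the first entry that survives [drop]: either [x] itself or
   a later, hence no larger, one. *)
case E : (count id m) => [|k] /=; first by rewrite drop0 top_sum_cons.
have ks : (k < size s)%N by rewrite -E -sm count_size.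
rewrite (drop_nth 0 ks) top_sum_cons lerD2r.
by apply: (allP xmin); rewrite mem_nth.
Qed.

End TopSum.

(** * The profitable range and the behaviour of the ratio beyond it *)

Section LCR.
Variables (R : realType) (g : nat -> R) (s : seq R).
Hypotheses (hg : cost_function g) (so : sorted >=%R s).
Local Notation m := (max_profitable g s).

Lemma max_profitable_size : (m <= size s)%N.
Proof.
by rewrite /max_profitable; apply/bigmax_leqP => j _; rewrite -ltnS ltn_ord.
Qed.

(** Values decrease and marginal costs increase along the list, so profitability at the last index
    of the range passes down to all earlier ones. *)
Lemma max_profitable_gt k : (k < m)%N -> g k.+1 - g k < s`_k.
Proof.
move=> km.
pose Q (j : 'I_(size s).+1) := (0 < j)%N && (0 < s`_j.-1 - (g j - g j.-1)).
have [j Qj] : exists2 j, Q j & m = j.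
  have [|/pred0P Q0] := pickP Q.
    move=> j0 Qj0; have := @eq_bigmax_cond _ Q (fun j => nat_of_ord j).
    by case=> [|j Qj mj]; [apply/card_gt0P; exists j0 | exists j].
  by move: km; rewrite /max_profitable big_pred0// => j; exact: (pred0P Q0).
case/andP: Qj => j0 jP mj; rewrite mj in km.
have jE : nat_of_ord j = j.-1.+1 by rewrite prednK.
have js : (j.-1 < size s)%N by have := ltn_ord j; rewrite {1}jE ltnS.
have kj : (k <= j.-1)%N by rewrite -ltnS -jE.
apply: le_lt_trans (marginal_cost_mono hg kj) _.
rewrite -jE -subr_gt0; apply: lt_le_trans jP _.
by rewrite lerD2r sorted_ge_nth// kj.
Qed.

Lemma max_profitable_le k : (m <= k < size s)%N -> s`_k <= g k.+1 - g k.
Proof.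
case/andP=> mk ks; rewrite leNgt; apply/negP => h.
have : (k.+1 <= m)%N.
  rewrite -[k.+1]/(nat_of_ord (Ordinal (ks : (k.+1 < (size s).+1)%N))).
  by apply: leq_bigmax_cond; rewrite /= subr_gt0.
by rewrite ltnNge mk.
Qed.

Lemma P_lcrS k : (k < size s)%N ->
  P_lcr g s k.+1 = P_lcr g s k + (s`_k - (g k.+1 - g k)).
Proof. by move=> ks; rewrite /P_lcr top_sumS//; ring. Qed.

Lemma P_lcr_gt0 k : (0 < k <= m)%N -> 0 < P_lcr g s k.
Proof.
have P0 : P_lcr g s 0 = 0 by rewrite /P_lcr top_sum0 (cost0 hg) subr0.
elim: k => [//|k IH] /andP[_ km].
have ks := leq_trans km max_profitable_size.
rewrite P_lcrS// ltr_wpDl ?subr_gt0 ?max_profitable_gt//.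
case: k => [|k] in IH km ks *; first by rewrite P0.
by apply/ltW/IH; rewrite /= ltnW.
Qed.

Lemma C_Greedy_ge i j : (j <= size (drop i s))%N ->
  top_sum (drop i s) j - g j <= C_Greedy g s i.
Proof.
move=> ji; rewrite /C_Greedy.
exact: (@le_bigmax _ _ _ 0 (fun j : 'I_(size (drop i s)).+1 =>
  top_sum (drop i s) j - g j) (Ordinal (ji : (j < (size (drop i s)).+1)%N))).
Qed.

Lemma C_Greedy_ge0 i : 0 <= C_Greedy g s i.
Proof.
have := C_Greedy_ge (leq0n (size (drop i s))).
by rewrite top_sum0 (cost0 hg) subr0.
Qed.

Lemma C_GreedyP i : exists2 j, (j <= size (drop i s))%N &
  C_Greedy g s i = top_sum (drop i s) j - g j.
Proof.
rewrite /C_Greedy; elim/big_ind: _ => [|x y [j jd ->] [k kd ->]|j _].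
(* The default 0 of the maximum is the term [j = 0]. *)
- by exists 0%N; rewrite // top_sum0 (cost0 hg) subr0.
- by rewrite maxEle; case: ifP => _; [exists k | exists j].
- by exists j => //; rewrite -ltnS.
Qed.

(** Each side is the numerator of [LCR] minus its denominator. A nonempty greedy choice that loses
    the [k]-th value drops by at most this value minus [g 1], which the growth of the cost term
    covers. *)
Lemma C_Greedy_step k : (k < size s)%N -> s`_k <= g k.+1 - g k ->
  g k - k%:R * g 1%N + C_Greedy g s k <=
  g k.+1 - k.+1%:R * g 1%N + C_Greedy g s k.+1.
Proof.
move=> ks sk; rewrite [k.+1%:R]mulrSr mulrDl mul1r.
have c1 := marginal_cost_ge1 hg k.
have [[|j]] := C_GreedyP k.
  by rewrite top_sum0 (cost0 hg) => _ ->; have := C_Greedy_ge0 k.+1; lra.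
rewrite (drop_nth 0 ks) top_sum_cons /= ltnS => jk ->.
have := C_Greedy_ge jk; have := marginal_cost_ge1 hg j; lra.
Qed.

(** Beyond [m], numerator minus denominator does not decrease and [P_lcr] does not increase; as
    [r >= 1], the bound descends from [k] to [m]. It is stated as a product because [P_lcr] may fail
    to be positive beyond [m]. *)
Lemma LCR_le_ex (r : R) k : 1 <= r -> (0 < m)%N -> (0 < k <= size s)%N ->
    M_lcr g s k + C_Greedy g s k <= r * P_lcr g s k ->
  exists2 i, (0 < i <= m)%N & LCR g s i <= r.
Proof.
move=> r1 m0.
have LCRr i : (0 < i <= m)%N -> M_lcr g s i + C_Greedy g s i <= r * P_lcr g s i ->
    LCR g s i <= r.
  by move=> im; rewrite /LCR ler_pdivrMr// P_lcr_gt0.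
have [km /andP[k0 _] h|mk /andP[_ ks]] := leqP k m.
  by exists k; [rewrite k0|apply: LCRr; rewrite ?k0].
suff h d : (m + d <= size s)%N ->
    M_lcr g s (m + d) + C_Greedy g s (m + d) <= r * P_lcr g s (m + d) ->
    M_lcr g s m + C_Greedy g s m <= r * P_lcr g s m.
  move=> hk; exists m; rewrite ?m0 ?leqnn//; apply: LCRr; rewrite ?m0 ?leqnn//.
  by apply: (h (k - m)%N); rewrite subnKC// ltnW.
elim: d => [|d IH]; first by rewrite addn0.
rewrite addnS => ds h; apply: IH; first exact: ltnW.
have sk : s`_(m + d) <= g (m + d).+1 - g (m + d)%N.
  by rewrite max_profitable_le// leq_addr.
have stp := C_Greedy_step ds sk.
move: h stp; rewrite /M_lcr /P_lcr top_sumS//.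
move: (C_Greedy _ _ _) (C_Greedy _ _ _) => c c'.
move: (top_sum _ _) => V h stp.
have : (r - 1) * (s`_(m + d) - (g (m + d).+1 - g (m + d)%N)) <= 0.
  by rewrite mulr_ge0_le0 ?subr_ge0 ?subr_le0.
move: h stp; rewrite !mulrBr mulrDr !mulrBl !mul1r; lra.
Qed.

End LCR.

(** * Feasible schedules and the offline optimum *)

Section Profit.
Variables (R : realType) (g : nat -> R) (sigma : seq (job R)).
Hypothesis hg : cost_function g.
Local Notation v := (value_at sigma).
Local Notation slot_profit X := (\sum_(i <- X) v i - g #|` X|).

(** There are finitely many jobs and each occupies at most one slot, even with infinite
    deadlines. *)
Lemma feasible_horizon P : feasible sigma P ->
  exists T, forall t, (T < t)%N -> P t = fset0.
Proof.
case=> Plive Pinj.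
suff [T HT] : exists T, forall t i, (T < t)%N -> (i < size sigma)%N -> i \notin P t.
  exists T => t Tt; apply/fsetP => i; rewrite inE; apply/negbTE/negP => iP.
  have [isz _] := Plive t i (leq_ltn_trans (leq0n T) Tt) iP.
  by have := HT t i Tt isz; rewrite iP.
elim: (size sigma) => [|n [T HT]]; first by exists 0%N.
have [[t0 [t00 nP]]|nP] := pselect (exists t, (0 < t)%N /\ n \in P t).
  exists (maxn T t0) => t i; rewrite gtn_max => /andP[Tt t0t].
  rewrite ltnS leq_eqVlt => /orP[/eqP->|/HT]; last exact.
  apply/negP => nt; have := Pinj t t0 n (ltn_trans t00 t0t) t00 nt nP.
  by move=> tt0; rewrite tt0 ltnn in t0t.
exists T => t i Tt; rewrite ltnS leq_eqVlt => /orP[/eqP->|/HT]; last exact.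
by apply/negP => nt; apply: nP; exists t; split=> //; exact: leq_ltn_trans Tt.
Qed.

Lemma profit_sum P T : (forall t, (T < t)%N -> P t = fset0) ->
  profit g sigma P = \sum_(1 <= t < T.+1) slot_profit (P t).
Proof.
move=> PT; rewrite /profit (fsbigE (index_iota 1 T.+1)) ?iota_uniq//.
- rewrite big_seq_cond [RHS]big_seq_cond; apply: eq_bigl => t.
  rewrite andbT mem_index_iota; case: (ltnP 0 t) => //= t0.
  by rewrite mem_set ?andbT.
- by move=> t /=; rewrite mem_index_iota => /andP[].
- move=> t /= t0; rewrite mem_index_iota t0 /= -leqNgt => /PT ->.
  by rewrite big_seq_fset0 cardfs0 (cost0 hg) subr0.
Qed.

(** Every element of [D] is counted in at most one slot. The induction removes from [D] the elements
    of the last slot, which by disjointness occur in no earlier one. *)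
Lemma sum_disjoint_le (w : nat -> R) (X : nat -> {fset nat}) (D : {fset nat}) T :
    (forall t u i, (0 < t)%N -> (0 < u)%N -> i \in X t -> i \in X u -> t = u) ->
    {in D, forall i, 0 <= w i} ->
  \sum_(1 <= t < T.+1) \sum_(i <- X t `&` D) w i <= \sum_(i <- D) w i.
Proof.
move=> Xinj; elim: T D => [|T IH] D w0.
  by rewrite big_geq// big_seq sumr_ge0.
rewrite big_nat_recr//= (big_fsetID _ (mem (X T.+1)) D) /= addrC.
have -> : [fset x in D | x \in X T.+1] = X T.+1 `&` D.
  by apply/fsetP => i; rewrite !inE/= andbC.
rewrite lerD2l; set D' := [fset x in D | _].
rewrite [leLHS](_ : _ = \sum_(1 <= t < T.+1) \sum_(i <- X t `&` D') w i).
  by apply: IH => i; rewrite !inE => /andP[iD _]; exact: w0.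
rewrite !big_nat; apply: eq_bigr => t /andP[t0 tT].
apply: (congr1 (fun Y : {fset nat} => \sum_(i <- Y) w i)).
apply/fsetP => i; rewrite !inE/=; case it: (i \in X t) => //=.
case: (i \in D) => //=; apply/esym/negP => iT.
by move: tT; rewrite (Xinj _ _ _ t0 (ltn0Sn T) it iT) ltnn.
Qed.

Hypothesis hs : valid_input sigma.

Lemma value_at_gt0 i : (i < size sigma)%N -> 0 < v i.
Proof.
by move=> isz; case/andP: hs => /(all_nthP (Job 0 0 None))/(_ i isz)/and3P[].
Qed.

(** This bound makes the [sup] in [C_OFF] a genuine supremum. *)
Lemma profit_ub P : feasible sigma P ->
  profit g sigma P <= \sum_(i <- [fset i in iota 0 (size sigma)]) v i.
Proof.
move=> fP; have [T HT] := feasible_horizon fP; rewrite (profit_sum HT).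
case: fP => Plive Pinj.
apply: le_trans (sum_disjoint_le T Pinj _); last first.
  by move=> i; rewrite inE mem_iota add0n => /value_at_gt0/ltW.
rewrite big_nat [leRHS]big_nat ler_sum// => t /andP[t0 _].
have -> : P t `&` [fset i in iota 0 (size sigma)] = P t.
  apply/fsetIidPl/fsubsetP => i /(Plive _ _ t0)[isz _].
  by rewrite inE mem_iota add0n.
by rewrite gerBl cost_ge0.
Qed.

Lemma feasible_empty : feasible sigma (fun=> fset0).
Proof. by split=> [t i _|t u i _ _]; rewrite inE. Qed.

Lemma profit_empty : profit g sigma (fun=> fset0) = 0.
Proof. by rewrite (profit_sum (T := 0)) ?big_geq. Qed.

Lemma profit_le_OFF P : feasible sigma P -> profit g sigma P <= C_OFF g sigma.
Proof.
move=> fP; apply: ub_le_sup; last by exists P.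
by eexists => _ [Q fQ <-]; exact: profit_ub.
Qed.

Lemma OFF_ge0 : 0 <= C_OFF g sigma.
Proof. by rewrite -profit_empty profit_le_OFF//; exact: feasible_empty. Qed.

Lemma OFF_le (x : R) : (forall P, feasible sigma P -> profit g sigma P <= x) ->
  C_OFF g sigma <= x.
Proof.
move=> Hx; apply: ge_sup.
  by eexists; exists (fun=> fset0) => //; exact: feasible_empty.
by move=> _ [P fP <-]; exact: Hx.
Qed.

End Profit.

(** * The run of an online algorithm as a feasible schedule *)

Section Exec.
Variables (R : realType) (A : online_algorithm R) (sigma : seq (job R)).
Local Notation done t := (exec A sigma t).2.

Lemma exec_historyS t : (exec A sigma t.+1).1 = rcons (exec A sigma t).1
  (view_at sigma t.+1 (available_at A sigma t.+1)).
Proof. by rewrite /available_at /=; case: (exec A sigma t). Qed.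

Lemma doneS t : done t.+1 = done t `|` processed_at A sigma t.+1.
Proof. by rewrite /processed_at /=; case: (exec A sigma t). Qed.

Lemma processed_at_sub t : (0 < t)%N ->
  processed_at A sigma t `<=` available_at A sigma t.
Proof.
case: t => // t _; rewrite /processed_at /decide /last_view exec_historyS last_rcons.
exact: fsubsetIl.
Qed.

Lemma mem_available_at t i : (i \in available_at A sigma t) =
  [&& (i < size sigma)%N, live sigma t i & i \notin done t.-1].
Proof. by rewrite /available_at /available !inE mem_iota add0n. Qed.

Lemma done_mono t u : (t <= u)%N -> done t `<=` done u.
Proof.
move=> /subnKC <-; elim: (u - t)%N => [|d IH]; first by rewrite addn0.
by rewrite addnS doneS; apply: fsubset_trans IH (fsubsetUl _ _).
Qed.

Lemma processed_done t u : (0 < t <= u)%N -> processed_at A sigma t `<=` done u.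
Proof.
case: t => // t /= /done_mono; apply: fsubset_trans.
by rewrite doneS fsubsetUr.
Qed.

Lemma processed_not_done t i : (0 < t)%N -> i \in processed_at A sigma t ->
  i \notin done t.-1.
Proof.
by move=> t0 /(fsubsetP (processed_at_sub t0)); rewrite mem_available_at => /and3P[].
Qed.

Lemma feasible_processed : feasible sigma (processed_at A sigma).
Proof.
split=> [t i t0 /(fsubsetP (processed_at_sub t0))|].
  by rewrite mem_available_at => /and3P[].
suff H t u i : (0 < t)%N -> (t < u)%N -> i \in processed_at A sigma t ->
    i \notin processed_at A sigma u.
  move=> t u i t0 u0 it iu; case: (ltngtP t u) => // [tu|ut].
    by have := H _ _ _ t0 tu it; rewrite iu.
  by have := H _ _ _ u0 ut iu; rewrite it.
move=> t0 tu it; apply/negP => /(processed_not_done (leq_ltn_trans (leq0n t) tu)).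
by rewrite (fsubsetP (processed_done (u := u.-1) _) _ it)// t0 -ltnS (ltn_predK tu).
Qed.

Lemma sum_done (w : nat -> R) T : \sum_(i <- done T) w i =
  \sum_(1 <= t < T.+1) \sum_(i <- processed_at A sigma t) w i.
Proof.
elim: T => [|T IH]; first by rewrite big_geq// big_seq_fset0.
rewrite big_nat_recr//= -IH -[LHS]/(\sum_(i <- done T.+1) w i) doneS.
have nd i : i \in processed_at A sigma T.+1 -> i \notin done T.
  exact: (@processed_not_done T.+1).
move: (processed_at A sigma T.+1) (done T) nd => S D nd.
rewrite (big_fsetID _ (mem D)) /=; congr (_ + _);
  apply: (congr1 (fun Y : {fset nat} => \sum_(i <- Y) w i));
  apply/fsetP => i; rewrite !inE/=.
- by case: (i \in D); rewrite ?andbF.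
- case iD: (i \in D); rewrite ?andbF ?andbT//=.
  by apply/esym/negP => /nd; rewrite iD.
Qed.

End Exec.

Lemma sum_subr_const (R : realType) (l : seq nat) (F : nat -> R) (c : R) :
  \sum_(i <- l) (F i - c) = \sum_(i <- l) F i - (size l)%:R * c.
Proof.
elim: l => [|i l IH]; first by rewrite !big_nil mul0r subr0.
by rewrite !big_cons IH /= mulrSr; ring.
Qed.

(** * Passing between ratios and inequalities *)

Section Ratio.
Variable R : realType.
Implicit Types off alg r : R.

Lemma profit_ratio_ge1 off alg : 0 <= off -> alg <= off ->
  (1 <= profit_ratio off alg)%E.
Proof.
rewrite /profit_ratio => o0 ao; case: ifPn => [a0|_].
  by rewrite lee_fin ler_pdivlMr// mul1r.
by case: ifP => _ //; rewrite leey.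
Qed.

Lemma profit_ratio_le off alg r : (profit_ratio off alg <= r%:E)%E ->
  off <= r * alg /\ (alg <= 0 -> off = 0).
Proof.
rewrite /profit_ratio; case: ltP => [a0|a0]; last first.
  by case: ifP => [/andP[/eqP-> /eqP->]|_]; rewrite ?leye_eq// mulr0 => _.
by rewrite lee_fin ler_pdivrMr.
Qed.

Lemma le_profit_ratio off alg r : 1 <= r -> 0 <= off -> off <= r * alg ->
  (profit_ratio off alg <= r%:E)%E.
Proof.
move=> r1 o0 oa; rewrite /profit_ratio; case: ltP => a0.
  by rewrite lee_fin ler_pdivrMr.
have r0 : 0 < r by exact: lt_le_trans r1.
have a1 : alg = 0.
  by apply/eqP; rewrite eq_le a0 -(pmulr_rge0 _ r0) (le_trans o0).
have -> : off = 0 by apply/eqP; rewrite eq_le o0 andbT (le_trans oa)// a1 mulr0.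
by rewrite a1 !eqxx lee_fin.
Qed.

End Ratio.

(** * Lower bound: the adversary with all arrivals in slot 1 *)

Section OneSlot.
Variables (R : realType) (g : nat -> R) (B : online_algorithm R) (s : seq R).
Hypotheses (hg : cost_function g) (so : sorted >=%R s).
Hypothesis s_gt0 : forall i, (i < size s)%N -> 0 < s`_i.
Local Notation n := (size s).

(** Written without reference to the input, so that the choice of [B] is known before the deadlines
    are defined from it. *)
Definition one_slot_history : seq (view R) :=
  [:: View [seq (1%N, s`_i) | i <- iota 0 n] [fset i in iota 0 n]].

Definition one_slot_choice : {fset nat} := decide B one_slot_history.
Local Notation S := one_slot_choice.

(* The deadlines depend on the decision of [B] in slot 1, which [B] takes before
   it can observe any of them. *)
Definition one_slot_job (i : nat) : job R :=
  Job 1 s`_i (if i \in S then None else Some 1%N).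

Definition one_slot_input : seq (job R) := [seq one_slot_job i | i <- iota 0 n].
Local Notation sigma := one_slot_input.

Lemma job_at_one_slot i : (i < n)%N -> job_at sigma i = one_slot_job i.
Proof. by move=> isz; rewrite /job_at (nth_map 0%N) ?size_iota// nth_iota. Qed.

Lemma value_at_one_slot i : (i < n)%N -> value_at sigma i = s`_i.
Proof. by move=> isz; rewrite /value_at job_at_one_slot. Qed.

Lemma size_one_slot : size sigma = n.
Proof. by rewrite size_map size_iota. Qed.

Lemma live_one_slot t i : (i < n)%N ->
  live sigma t i = (0 < t)%N && ((i \in S) || (t <= 1)%N).
Proof. by move=> isz; rewrite /live job_at_one_slot//=; case: (i \in S). Qed.

Lemma valid_one_slot : valid_input sigma.
Proof.
apply/andP; split.
  apply/(all_nthP (Job 0 0 None)) => i; rewrite size_one_slot => isz.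
  rewrite -[nth _ _ _]/(job_at sigma i) job_at_one_slot// /valid_job /=.
  by rewrite s_gt0//; case: (i \in S).
by rewrite -map_comp; elim: (iota 0 n) => //= a [|b l].
Qed.

(** All jobs are live in slot 1, so the real observation there is [one_slot_history]. Later only the
    jobs of [S] are live, and these are already done. *)
Lemma processed_one_slot t :
  processed_at B sigma t.+1 = if t == 0%N then S else fset0.
Proof.
have S1 : processed_at B sigma 1 = S.
  rewrite /processed_at /S /one_slot_history /= /view_at /available /=.
  congr (decide B [:: View _ _]).
    by rewrite filter_map -map_comp; elim: (iota 0 n) => //= a l ->.
  apply/fsetP => i; rewrite !inE !mem_iota !add0n size_one_slot /= andbT.
  by case: ltnP => //= isz; rewrite live_one_slot//= orbT.
case: t => [//|t] /=; apply/fsetP => i; rewrite inE; apply/negbTE/negP => iP.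
have := fsubsetP (processed_at_sub _ _ (ltn0Sn t.+1)) _ iP.
rewrite mem_available_at size_one_slot => /and3P[isz].
rewrite live_one_slot//= orbF => iS /negP; apply.
have D1 := processed_done B sigma (isT : (0 < 1 <= t.+1)%N).
by apply: (fsubsetP D1); rewrite S1.
Qed.

Lemma one_slot_choice_lt i : i \in S -> (i < n)%N.
Proof. by rewrite /one_slot_choice /decide !inE mem_iota add0n => /andP[]. Qed.

Lemma ALG_one_slot : C_ALG g B sigma = \sum_(i <- S) s`_i - g #|` S|.
Proof.
rewrite /C_ALG (@profit_sum _ _ _ hg _ 1) => [|[|[|t]] _ //];
  last exact: processed_one_slot.
rewrite big_nat1 processed_one_slot /=; congr (_ - _).
rewrite big_seq [RHS]big_seq; apply: eq_bigr => i /one_slot_choice_lt.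
exact: value_at_one_slot.
Qed.

Lemma OFF_one_slot (T : {fset nat}) : {in T, forall i, (i < n)%N && (i \notin S)} ->
  \sum_(i <- T) s`_i - g #|` T| + \sum_(i <- S) (s`_i - g 1%N) <= C_OFF g sigma.
Proof.
move=> HT.
(* Slot 1 serves [T], and job [i] of [S] is alone in slot [i + 2], at cost [g 1]. The last slot that
   can be used is therefore [n + 1]. *)
pose P t := if (t <= 1)%N then T else if t.-2 \in S then [fset t.-2] else fset0.
have fP : feasible sigma P.
  have PS t i : (1 < t)%N -> i \in P t -> i \in S /\ t = i.+2.
    rewrite /P => t1; rewrite leqNgt t1 /=.
    case: ifP => [tS|]; rewrite inE// => /eqP->.
    by split=> //; case: t t1 {tS} => [|[]].
  have PT i : i \in T -> i \notin S by move=> /HT/andP[].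
  split=> [t i t0|t u i t0 u0].
    rewrite size_one_slot; have [t1|t1] := leqP t 1%N.
      rewrite /P t1 => /HT/andP[isz _]; split=> //.
      by rewrite live_one_slot// t0 t1 orbT.
    move=> /(PS _ _ t1)[iS _]; have isz := one_slot_choice_lt iS.
    by split; rewrite // live_one_slot// t0 iS.
  have [t1|t1] := leqP t 1%N; have [u1|u1] := leqP u 1%N.
  - by move=> _ _; apply/eqP; rewrite eqn_leq (leq_trans t1) ?(leq_trans u1).
  - by rewrite {1}/P t1 => /PT/negP + /(PS _ _ u1)[].
  - by move=> /(PS _ _ t1)[iS _]; rewrite /P u1 => /PT; rewrite iS.
  - by move=> /(PS _ _ t1)[_ ->] /(PS _ _ u1)[_ ->].
apply: le_trans (profit_le_OFF hg valid_one_slot fP).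
rewrite (@profit_sum _ _ _ hg _ n.+1); last first.
  move=> [|[|t]]//=; rewrite !ltnS => nt; rewrite /P /=.
  by case: ifP => // /one_slot_choice_lt; rewrite ltnNge nt.
rewrite big_ltn// /P lerD//.
  rewrite le_eqVlt; apply/orP; left; apply/eqP; congr (_ - _).
  rewrite big_seq [RHS]big_seq; apply: eq_bigr => i /HT/andP[isz _].
  by rewrite value_at_one_slot.
rewrite 2!big_add1 /=.
rewrite [leRHS](_ : _ = \sum_(0 <= i < n | i \in S) (s`_i - g 1%N)); last first.
  rewrite [RHS]big_mkcond big_nat [RHS]big_nat; apply: eq_bigr => i /= isz.
  case: ifP => _; last by rewrite big_seq_fset0 cardfs0 (cost0 hg) subr0.
  by rewrite big_seq_fset1 cardfs1 value_at_one_slot.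
rewrite le_eqVlt; apply/orP; left; apply/eqP.
rewrite -[RHS]big_filter; apply: perm_big; apply: uniq_perm => [||i].
- exact: fset_uniq.
- by rewrite filter_uniq// iota_uniq.
- rewrite mem_filter mem_index_iota /=.
  by case iS: (i \in S); rewrite ?(one_slot_choice_lt iS).
Qed.

Lemma OFF_one_slot_ge :
  \sum_(i <- S) s`_i - #|` S|%:R * g 1%N + C_Greedy g s #|` S| <= C_OFF g sigma
  /\ \sum_(i <- S) s`_i <= top_sum s #|` S|.
Proof.
(* The set [S] is encoded as a mask on the sorted list, which turns sums over jobs into sums over
   sublists of [s]. *)
pose m : bitseq := [seq i \in S | i <- iota 0 n].
pose rest := [seq i <- iota 0 n | i \notin S].
have szm : size m = n by rewrite size_map size_iota.
have perm_S : perm_eq S [seq i <- iota 0 n | i \in S].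
  apply: uniq_perm => [||i]; rewrite ?fset_uniq// ?filter_uniq ?iota_uniq//.
  rewrite mem_filter mem_iota add0n.
  by case iS: (i \in S) => //=; rewrite (one_slot_choice_lt iS).
have cS : #|` S| = count id m.
  by rewrite (perm_size perm_S) size_filter count_map.
have sE : [seq s`_i | i <- iota 0 n] = s by rewrite -[RHS](mkseq_nth 0).
have SE : \sum_(i <- S) s`_i = \sum_(x <- mask m s) x.
  transitivity (\sum_(x <- [seq s`_i | i <- mask m (iota 0 n)]) x).
    by rewrite (perm_big _ perm_S) filter_mask big_map.
  by rewrite map_mask sE.
have restE : [seq s`_i | i <- rest] = mask (map negb m) s.
  by rewrite /rest filter_mask map_mask sE -map_comp.
split; last first.
  by rewrite SE cS -(size_mask szm) sum_subseq_le_top_sum ?mask_subseq.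
have [j jn ->] := C_GreedyP s hg #|` S|.
have szr : size (mask (map negb m) s) = (n - #|` S|)%N.
  rewrite size_mask ?(size_map negb)// cS -szm -(count_predC id m) addKn.
  by rewrite count_map.
(* As [s] is sorted, these are [j] largest jobs outside [S], with [j] the count that attains
   [C_Greedy]. *)
pose T := [fset i in take j rest].
have restU : uniq rest by rewrite filter_uniq// iota_uniq.
have perm_T : perm_eq T (take j rest).
  apply: uniq_perm => [||i]; rewrite ?fset_uniq// ?take_uniq//.
  by rewrite inE.
have szrest : (j <= size rest)%N.
  by rewrite -(size_map (nth 0 s)) restE szr -size_drop.
have HT : {in T, forall i, (i < n)%N && (i \notin S)}.
  move=> i; rewrite inE => /mem_take; rewrite mem_filter mem_iota add0n /=.
  by case/andP => -> ->.
apply: le_trans (OFF_one_slot HT).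
rewrite sum_subr_const (perm_size perm_T) size_takel// (perm_big _ perm_T) /=.
have -> : \sum_(i <- take j rest) s`_i = top_sum (mask (map negb m) s) j.
  by rewrite /top_sum -restE -map_take big_map.
rewrite addrC lerD2r// lerD2r cS top_sum_drop_le_mask//.
by rewrite szr -size_drop.
Qed.

Lemma LCR_le_ratio (r : R) : (competitive_ratio g B <= r%:E)%E -> 1 <= r ->
  (0 < max_profitable g s)%N ->
  exists2 i, (0 < i <= max_profitable g s)%N & LCR g s i <= r.
Proof.
move=> Br r1 m0.
have /profit_ratio_le[] : (profit_ratio (C_OFF g sigma) (C_ALG g B sigma) <= r%:E)%E.
  by apply: le_trans Br; apply: ereal_sup_ubound; exists sigma => //;
    exact: valid_one_slot.
rewrite ALG_one_slot; have [] := OFF_one_slot_ge.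
have : (#|` S| <= n)%N.
  have -> : n = #|` [fset i in iota 0 n]|.
    by rewrite card_fseq undup_id ?iota_uniq// size_iota.
  by apply: fsubset_leq_card; exact: fsubsetIl.
(* If [B] processes nothing, its finite ratio forces zero offline profit, whereas the largest value
   exceeds [g 1]. *)
have [/cardfs0_eq ->|k0] := posnP #|` S|.
  rewrite cardfs0 big_seq_fset0 (cost0 hg) mul0r !subr0 add0r.
  move=> _ off _ _ /(_ (lexx _)).
  have n0 : (0 < n)%N by apply: leq_trans (max_profitable_size g s).
  have := C_Greedy_ge g (i := 0) (s := s) (j := 1); rewrite drop0 => /(_ n0).
  rewrite (top_sumS n0) top_sum0 add0r.
  have := max_profitable_gt hg so m0; rewrite (cost0 hg) subr0; lra.
move: (#|` S|) k0 (\sum_(i <- S) s`_i) => k k0 a kn off aV offr _.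
apply: (LCR_le_ex hg so r1 m0 (k := k)); first by rewrite k0.
(* Raising the value [a] of [S] to [top_sum s k] adds the difference once to the offline side and
   [r >= 1] times to the other. *)
have : (r - 1) * a <= (r - 1) * top_sum s k by rewrite ler_wpM2l ?subr_ge0.
have := le_trans off offr; rewrite /M_lcr /P_lcr !mulrBr !mulrBl !mul1r; lra.
Qed.

End OneSlot.

(** * The inequality for a single slot of min-LCR *)

Section Slot.
Variables (R : realType) (g : nat -> R) (v : nat -> R).
Hypothesis hg : cost_function g.

Let ge_tr : transitive (>=%R : rel R).
Proof. by move=> y x z /= yx zy; exact: le_trans zy yx. Qed.

Let ge_tot : total (>=%R : rel R).
Proof. by move=> x y /=; rewrite le_total. Qed.

Lemma sorted_values_sorted E : sorted >=%R (sorted_values v E).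
Proof. exact: sort_sorted. Qed.

Lemma size_sorted_values E : size (sorted_values v E) = #|` E|.
Proof. by rewrite size_sort size_map. Qed.

Lemma mem_sorted_values E i : i \in E -> v i \in sorted_values v E.
Proof. by move=> iE; rewrite mem_sort map_f. Qed.

Lemma sum_sorted_values E : \sum_(x <- sorted_values v E) x = \sum_(i <- E) v i.
Proof. by rewrite (perm_big _ (permEl (perm_sort _ _))) big_map. Qed.

(** The sorted list of a multiset of values is unique, so ties are harmless: cutting the list at [i]
    separates the values of [S] from the rest. *)
Lemma sorted_values_top E i S : is_top v E i S ->
  sorted_values v E = sorted_values v S ++ sorted_values v (E `\` S).
Proof.
case=> SE _ top; apply: (sorted_eq ge_tr); last 1 first.
- rewrite /sorted_values perm_sort perm_sym.
  apply: perm_trans (perm_map v (_ : perm_eq (S ++ (E `\` S)) E)).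
    by rewrite map_cat; apply: perm_cat; rewrite perm_sort.
  apply: uniq_perm => [||x]; rewrite ?fset_uniq//.
    rewrite cat_uniq !fset_uniq andbT /=; apply/hasPn => x.
    by rewrite !inE => /andP[].
  rewrite mem_cat !inE; case xS: (x \in S) => //=.
  by rewrite (fsubsetP SE).
- by move=> x y /= /andP[xy yx]; apply/eqP; rewrite eq_le xy yx.
- exact: sorted_values_sorted.
- rewrite sorted_pairwise// pairwise_cat -!sorted_pairwise//.
  rewrite !sorted_values_sorted !andbT.
  apply/allrelP => x y; rewrite !mem_sort => /mapP[a aS ->] /mapP[b + ->].
  by rewrite !inE => /andP[bS bE]; exact: top.
Qed.

Lemma sum_le_top_sum (N F : {fset nat}) : N `<=` F ->
  \sum_(i <- N) v i <= top_sum (sorted_values v F) #|` N|.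
Proof.
(* Listing [N] in the order of [F] gives a subsequence, which sorting preserves. *)
move=> NF; pose l := [seq i <- F | i \in N].
have perm_N : perm_eq N l.
  apply: uniq_perm => [||x]; rewrite ?fset_uniq ?filter_uniq ?fset_uniq//.
  by rewrite mem_filter; case xN: (x \in N) => //=; rewrite (fsubsetP NF).
rewrite -sum_sorted_values -size_sorted_values.
apply: sum_subseq_le_top_sum; first exact: sorted_values_sorted.
have -> : sorted_values v N = sort >=%R [seq v i | i <- l].
  apply/perm_sortP => //; last exact: perm_map.
  by move=> x y /= /andP[xy yx]; apply/eqP; rewrite eq_le xy yx.
by apply: subseq_sort => //; apply: map_subseq; exact: filter_subseq.
Qed.

(** In the application [N] holds the jobs that offline processes in the slot and min-LCR never does.
    The first conclusion supplies the nonnegative weights needed to sum over slots. *)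
Lemma min_LCR_slot (r : R) (E S N : {fset nat}) :
    ((0 < max_profitable g (sorted_values v E))%N ->
       exists2 i, (0 < i <= max_profitable g (sorted_values v E))%N &
         LCR g (sorted_values v E) i <= r) ->
    min_LCR_choice g v E S -> N `<=` E `\` S ->
  {in S, forall i, g 1%N <= v i} /\
  \sum_(i <- N) v i - g #|` N| + \sum_(i <- S) (v i - g 1%N) <=
    r * (\sum_(i <- S) v i - g #|` S|).
Proof.
rewrite /min_LCR_choice; have so := sorted_values_sorted E.
have nthE x : x \in E -> exists2 k, (k < size (sorted_values v E))%N &
    (sorted_values v E)`_k = v x.
  by move=> /mem_sorted_values/(nthP 0).
case: ifPn => [/eqP m0 _ -> NE|].
  split=> [i|]; rewrite ?inE// !big_seq_fset0 cardfs0 (cost0 hg) subr0 mulr0 addr0.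
  (* With an empty profitable range, the largest value is at most [g 1], hence so is every value in
     [N]. *)
  have vle i : i \in N -> v i - g 1%N <= 0.
    move=> /(fsubsetP NE); rewrite !inE /= => /nthE[k ks <-]; rewrite subr_le0.
    have s0 : (sorted_values v E)`_0 <= g 1%N - g 0%N.
      by apply: max_profitable_le; rewrite m0 (leq_ltn_trans _ ks).
    rewrite (cost0 hg) subr0 in s0; apply: le_trans s0.
    by apply: sorted_ge_nth.
  have : \sum_(i <- N) (v i - g 1%N) <= 0 by rewrite big_seq sumr_le0.
  by rewrite sum_subr_const; have := cost_ge_linear hg #|` N|; lra.
rewrite -lt0n => m0 /(_ m0)[k km LCRk] [i [im imin] itop] NE.
have iS : #|` S| = i by case: itop.
have sE := sorted_values_top itop.
have szS : size (sorted_values v S) = i by rewrite size_sorted_values.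
have takeE : take i (sorted_values v E) = sorted_values v S.
  by rewrite sE -szS take_size_cat.
have dropE : drop i (sorted_values v E) = sorted_values v (E `\` S).
  by rewrite sE -szS drop_size_cat.
have SV : \sum_(x <- S) v x = top_sum (sorted_values v E) i.
  by rewrite /top_sum takeE sum_sorted_values.
case/andP: (im) => i0 im'.
split=> [x /mem_sorted_values|].
  rewrite -takeE => /(nthP 0)[j]; rewrite takeE szS => ji <-.
  rewrite -takeE nth_take//.
  apply: le_trans (marginal_cost_ge1 hg j) _; apply: ltW.
  by apply: (max_profitable_gt hg so); exact: leq_trans im'.
have := le_trans (imin k km) LCRk.
rewrite {1}/LCR ler_pdivrMr ?(P_lcr_gt0 hg so)// /P_lcr /M_lcr -SV -iS => h.
rewrite sum_subr_const; apply: le_trans h; rewrite addrC lerD2l iS.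
apply: le_trans (C_Greedy_ge g (i := i) (j := #|` N|) _).
  by rewrite dropE lerD2r sum_le_top_sum.
by rewrite dropE size_sorted_values fsubset_leq_card.
Qed.

End Slot.

(** * Upper bound: summing the slot inequality over time *)

Section UpperBound.
Variables (R : realType) (g : nat -> R) (A : online_algorithm R) (r : R).
Hypotheses (hg : cost_function g) (hA : is_min_LCR g A).
Hypothesis LCR_r : forall s : seq R, sorted >=%R s ->
  (forall i, (i < size s)%N -> 0 < s`_i) -> (0 < max_profitable g s)%N ->
  exists2 i, (0 < i <= max_profitable g s)%N & LCR g s i <= r.

Lemma OFF_le_min_LCR (sigma : seq (job R)) : valid_input sigma ->
  C_OFF g sigma <= r * C_ALG g A sigma.
Proof.
move=> hs; apply: OFF_le => P fP.
have [T1 HT1] := feasible_horizon fP.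
have [T2 HT2] := feasible_horizon (feasible_processed A sigma).
pose T := maxn T1 T2.
rewrite /C_ALG (@profit_sum _ _ _ hg P T) => [|t tT]; last first.
  by apply: HT1; apply: leq_ltn_trans tT; exact: leq_maxl.
rewrite (@profit_sum _ _ _ hg _ T) => [|t tT]; last first.
  by apply: HT2; apply: leq_ltn_trans tT; exact: leq_maxr.
(* [D] is everything that min-LCR ever processes, since it is idle after [T]. *)
pose v := value_at sigma; pose D := (exec A sigma T).2.
have slot t N : (0 < t)%N ->
    N `<=` available_at A sigma t `\` processed_at A sigma t ->
    {in processed_at A sigma t, forall i, g 1%N <= v i} /\
    \sum_(i <- N) v i - g #|` N| + \sum_(i <- processed_at A sigma t) (v i - g 1%N)
      <= r * (\sum_(i <- processed_at A sigma t) v i -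
              g #|` processed_at A sigma t|).
  move=> t0; apply: min_LCR_slot (hA hs t0) => //.
  apply: LCR_r; first exact: sorted_values_sorted.
  move=> i /(mem_nth 0); rewrite mem_sort => /mapP[j jE ->].
  by apply: value_at_gt0 => //; move: jE; rewrite mem_available_at => /and3P[].
have Dge : {in D, forall i, 0 <= v i - g 1%N}.
  rewrite /D; elim: {D}T => [|u IH] i; first by rewrite inE.
  rewrite doneS inE => /orP[/IH//|iu]; rewrite subr_ge0.
  by have [+ _] := slot u.+1 fset0 isT (fsub0set _); exact.
case: (fP) => Plive Pinj.
pose N t := P t `\` D.
apply: (@le_trans _ _ (\sum_(1 <= t < T.+1) (\sum_(i <- N t) v i - g #|` N t|) +
    \sum_(1 <= t < T.+1) \sum_(i <- P t `&` D) (v i - g 1%N))).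
  rewrite -big_split /=; apply: ler_sum => t _.
  rewrite (big_fsetID _ (mem D)) /= -/v.
  have -> : [fset i in P t | i \in D] = P t `&` D by apply/fsetP => i; rewrite !inE.
  have -> : [fset i in P t | i \notin D] = N t.
    by apply/fsetP => i; rewrite !inE andbC.
  rewrite sum_subr_const.
  have := cost_addn hg #|` N t| #|` P t `&` D|.
  rewrite addnC cardfsID; lra.
(* The shared jobs are recounted in the slots where min-LCR processes them instead of those where
   offline does. *)
have := sum_disjoint_le T Pinj Dge.
move=> /(lerD (lexx (\sum_(1 <= t < T.+1) (\sum_(i <- N t) v i - g #|` N t|)))) h.
apply: le_trans h _; rewrite {1}/D sum_done -big_split /= mulr_sumr.
rewrite big_nat [leRHS]big_nat; apply: ler_sum => t /andP[t0 tT].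
have [|_ +] := slot t (N t) t0; last exact.
(* A job outside [D] is processed by min-LCR neither before slot [t] nor in it, so it is available
   there and left unchosen. *)
apply/fsubsetP => i.
rewrite [i \in N t]in_fsetD => /andP[iD /(Plive _ _ t0)[isz ilive]].
rewrite in_fsetD mem_available_at isz ilive /=; apply/andP; split; apply: contra iD.
  by apply/fsubsetP/processed_done; rewrite t0.
by apply/fsubsetP/done_mono; rewrite -ltnS (ltn_predK t0) ltnW.
Qed.

End UpperBound.

(** * Optimality: comparison with an arbitrary online algorithm *)

Lemma competitive_ratio_ge1 (R : realType) (g : nat -> R) (B : online_algorithm R) :
  cost_function g -> (1 <= competitive_ratio g B)%E.
Proof.
move=> hg; pose nl := [::] : seq (job R).
apply: (@le_trans _ _ (profit_ratio (C_OFF g nl) (C_ALG g B nl))).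
  apply: profit_ratio_ge1; first exact: OFF_ge0.
  by apply: profit_le_OFF => //; exact: feasible_processed.
by apply: ereal_sup_ubound; exists nl.
Qed.

Theorem theorem3p3 (R : realType) (g : nat -> R) (hg : cost_function g)
    (A : online_algorithm R) (hA : is_min_LCR g A) :
  competitive_ratio g A = optimal_competitive_ratio g.
Proof.
apply/eqP; rewrite eq_le; apply/andP; split; last first.
  by apply: ereal_inf_lbound; exists A.
apply: le_ereal_inf_tmp => _ [B _ <-].
have := competitive_ratio_ge1 B hg.
(* A finite ratio [r] of [B] bounds the least [LCR] of every list of positive values, which is what
   the upper bound requires. *)
case ratioB: (competitive_ratio g B) => [r| |].
- rewrite lee_fin => r1; apply: ge_ereal_sup => _ [sigma hs <-].
  apply: le_profit_ratio => //; first exact: OFF_ge0.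
  apply: OFF_le_min_LCR => // s so s_gt0 m0.
  by apply: (LCR_le_ratio hg so s_gt0 (B := B)) => //; rewrite ratioB lexx.
- by move=> _; rewrite leey.
- by rewrite leeNy_eq.
Qed.
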